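(* Let $E=\{(2,2)\}$, $\mu=\delta_{(2,2)}$, $u\equiv1$, and take on the interior $U^\circ$ the background $g_0=x^2y^2g_{\mathrm E}$. Then $A_\mu=4>2$, whereas $g_\mu=x^{-2}y^{-2}g_0=g_{\mathrm E}$. Thus the corner lies at finite distance (it is reached by curves of finite $g_\mu$-length) despite the supercritical exponent.
   Context: Let $k\ge0$, let $V\subset\mathbb R^k$ be open, $\varepsilon>0$, and $U^\circ=(0,\varepsilon)^2\times V$ with coordinates $(x,y,z)$ and Euclidean metric $g_{\mathrm E}$; the corner is $\{x=y=0\}$. For a finite positive measure $\mu$ with compact support $E\subset\mathbb R_{\ge0}^2$ and a positive coefficient $u$, put $F_\mu(x,y,z)=\int_E u(\alpha;x,y,z)x^{-\alpha_1}y^{-\alpha_2}\,d\mu(\alpha)$, $g_\mu=F_\mu g_0$, and $A_\mu=\max_{\alpha\in E}(\alpha_1+\alpha_2)$. *)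

(* Defs.v *)
From mathcomp Require Export all_boot all_order all_algebra.
From mathcomp Require Export all_classical all_reals all_analysis.
Export Order.TTheory GRing.Theory Num.Theory numFieldNormedType.Exports.

Set Implicit Arguments.
Unset Strict Implicit.
Unset Printing Implicit Defensive.

Local Open Scope classical_set_scope.
Local Open Scope ring_scope.

(* A point p = (x, y, z) of R^2 x R^k is a row vector of length k + 2.  The
   ambient norm on row vectors is the sup norm; it is used only for limits and
   derivatives, never for lengths. *)
Section Coordinates.
Context {R : realType} {k : nat}.
Implicit Types (p : 'rV[R]_k.+2) (V : set 'rV[R]_k).

Definition xcoord p : R := @lsubmx R 1 2 k p 0 0.
Definition ycoord p : R := @lsubmx R 1 2 k p 0 1.
Definition zcoord p : 'rV[R]_k := @rsubmx R 1 2 k p.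

Definition interior_chart (eps : R) V : set 'rV[R]_k.+2 :=
  [set p | [/\ 0 < xcoord p < eps, 0 < ycoord p < eps & V (zcoord p)]].

Definition corner V : set 'rV[R]_k.+2 :=
  [set p | [/\ xcoord p = 0, ycoord p = 0 & V (zcoord p)]].

End Coordinates.

Section Metrics.
Context {R : realType} {n : nat}.

(* A Riemannian metric is given by its Gram matrix in the coordinate frame. *)
Definition metric := 'rV[R]_n -> 'M[R]_n.

Definition euclidean_metric : metric := fun=> 1%:M.

Definition conformal (F : 'rV[R]_n -> R) (g : metric) : metric :=
  fun p => F p *: g p.

Definition speed (g : metric) (p v : 'rV[R]_n) : R :=
  Num.sqrt ((v *m g p *m v^T) 0 0).

End Metrics.
Arguments metric : clear implicits.

Section Distance.
Context {R : realType} {n : nat}.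
Implicit Types (g : metric R n.+1) (U C : set 'rV[R]_n.+1) (p q : 'rV[R]_n.+1).

Definition curve_length g (c : R -> 'rV[R]_n.+1) : \bar R :=
  (\int[lebesgue_measure]_(t in `]0%R, 1%R[) (speed g (c t) (derive1 c t))%:E)%E.

(* A curve [0, 1) -> U from p, C^1 on (0, 1), tending at time 1 to the point q,
   which need not lie in U. *)
Definition curve_to U p q (c : R -> 'rV[R]_n.+1) : Prop :=
  [/\ c 0 = p,
      (forall t, t \in `[0, 1[ -> U (c t)),
      {within [set` `[0, 1[], continuous c},
      (forall t, t \in `]0, 1[ -> derivable c t 1 /\ {for t, continuous (derive1 c)})
    & c t @[t --> 1^'-] --> q].

(* Infimum of the g-lengths of the curves in U from p to points of C; it is
   +oo when there is no such curve. *)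
Definition dist_to U g p C : \bar R :=
  ereal_inf [set curve_length g c | c in [set c | exists2 q, C q & curve_to U p q c]].

End Distance.

Section Weights.
Context {R : realType} {k : nat}.
Implicit Types (mu : {finite_measure set (R * R)%type -> \bar R})
  (u : R * R -> 'rV[R]_k.+2 -> R).

Definition msupport mu : set (R * R)%type :=
  [set a | forall W : set (R * R)%type, open W -> W a -> (0 < mu W)%E].

(* Compact support in the closed first quadrant, positive coefficient. *)
Definition weight_data (U : set 'rV[R]_k.+2) mu u : Prop :=
  [/\ compact (msupport mu),
      msupport mu `<=` [set a | 0 <= a.1 /\ 0 <= a.2]
    & forall a p, msupport mu a -> U p -> 0 < u a p].

Definition weight mu u (p : 'rV[R]_k.+2) : R :=
  Rintegral mu (msupport mu)
    (fun a => u a p * xcoord p `^ (- a.1) * ycoord p `^ (- a.2)).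

Definition maximum (S : set R) : R := get [set m | S m /\ ubound S m].

Definition max_exponent mu : R := maximum [set a.1 + a.2 | a in msupport mu].

End Weights.

(* Main.v *)
Require Import Defs.

Local Open Scope classical_set_scope.
Local Open Scope ring_scope.

(** For a Dirac mass the weight integral collapses to a single monomial ([msupport_dirac],
    [weight_dirac]). Here it is x^-2 y^-2, which exactly cancels the conformal factor x^2 y^2 of the
    background, so the resulting metric is Euclidean on the open chart. In that metric, the straight
    segment from an interior point to a corner point with the same z has constant speed and finite
    length ([segment_curve_to], [segment_length_lty]). The exponent sum 2 + 2 measures the weight
    alone and does not see the degeneracy of the background. *)

Lemma msupport_dirac (R : realType) (a : (R * R)%type) :
  msupport (dirac a : {finite_measure set (R * R)%type -> \bar R}) = [set a].
Proof.
apply/seteqP; split => [b supp_b | b -> W _ Wa]; last first.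
  by rewrite [X in (_ < X)%E]diracE mem_set.
have [//|/eqP ba] := pselect (b = a).
have closed_a : closed [set a].
  apply: accessible_closed_set1; apply: hausdorff_accessible.
  exact: norm_hausdorff.
(* The complement of the atom is an open neighbourhood of b of mass zero. *)
have := supp_b (~` [set a]) (closed_openC closed_a) (elimN eqP ba).
by rewrite [X in (_ < X)%E]diracE memNset ?ltxx//= => /(_ erefl).
Qed.

Lemma maximum_set1 (R : realType) (m : R) : maximum [set m] = m.
Proof.
rewrite /maximum.
(* [get] is meaningful only on an inhabited set, so a witness comes first. *)
have : [set m' | [set m] m' /\ ubound [set m] m'] m by split => // x ->.
by move=> /getI [].
Qed.

Lemma weight_dirac (R : realType) (k : nat) (a : (R * R)%type) u
    (p : 'rV[R]_k.+2) :
  weight (dirac a : {finite_measure set (R * R)%type -> \bar R}) u p =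
  u a p * xcoord p `^ (- a.1) * ycoord p `^ (- a.2).
Proof.
have measurable_a : measurable [set a].
  (* A point is a measurable rectangle in the product sigma-algebra. *)
  have -> : [set a] = [set a.1] `*` [set a.2].
    by apply/seteqP; split => [_ ->//|[b1 b2] /= [-> ->]]; case: a.
  by apply: measurableX; exact: measurable_set1.
rewrite /weight msupport_dirac /Rintegral integral_dirac//; last first.
  exact: measurable_fun_set1.
by rewrite diracE mem_set//= mul1r.
Qed.

(** Away from h = 0 the difference quotient is constantly v. *)
Lemma is_derive_line {R : realType} {W : normedModType R} (p v : W) (t : R) :
  is_derive t 1 (fun s : R => p + s *: v) v.
Proof.
have cvg_quot : h^-1 *: (((fun s : R => p + s *: v) \o shift t) (h *: (1 : R))
    - (p + t *: v)) @[h --> (0 : R)^'] --> v.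
  apply: cvg_near_cst; near=> h.
  have h_neq0 : h != 0 by near: h; exact: nbhs_dnbhs_neq.
  rewrite /= opprD addrACA subrr add0r -scalerBl addrK scalerA.
  by rewrite [h *: 1]mulr1 mulVf ?scale1r.
by apply: DeriveDef; [exact: cvgP cvg_quot | exact: cvg_lim cvg_quot].
Unshelve. all: by end_near. Qed.

Lemma continuous_line (R : realType) (W : normedModType R) (p v : W) :
  continuous (fun s : R => p + s *: v).
Proof. by move=> t; apply: cvgD; [exact: cvg_cst | exact: cvgZr_tmp]. Qed.

Definition segment {R : realType} {W : normedModType R} (p q : W) (t : R) : W :=
  p + t *: (q - p).

Section SegmentToCorner.
Context {R : realType} {k : nat} {V : set 'rV[R]_k} {eps : R}.
Context {p q : 'rV[R]_k.+2}.
Context (Up : interior_chart eps V p) (Cq : corner V q).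
Context (zpq : zcoord p = zcoord q).

Let c : R -> 'rV[R]_k.+2 := segment p q.

(** Since q has x = y = 0, the first two coordinates shrink by the factor 1 - t, which is positive
    for t < 1. By [zpq] the z-coordinate is constant, so the path stays over V although V may fail
    to be convex. *)
Lemma segment_interior t : t \in `[0, 1[ -> interior_chart eps V (c t).
Proof.
rewrite in_itv/= => /andP[t0 t1].
case: Up => /andP[xp0 xpe] /andP[yp0 ype] Vz; case: Cq => xq0 yq0 _.
have s0 : 0 < 1 - t by rewrite subr_gt0.
have s1 : 1 - t <= 1 by rewrite gerBl.
have -> : c t = (1 - t) *: p + t *: q.
  by rewrite /c /segment scalerBr scalerBl scale1r addrCA addrC.
have xE : xcoord ((1 - t) *: p + t *: q) = (1 - t) * xcoord p.
  by move: xq0; rewrite /xcoord !mxE => ->; rewrite mulr0 addr0.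
have yE : ycoord ((1 - t) *: p + t *: q) = (1 - t) * ycoord p.
  by move: yq0; rewrite /ycoord !mxE => ->; rewrite mulr0 addr0.
have zE : zcoord ((1 - t) *: p + t *: q) = zcoord p.
  apply/rowP => j; move/rowP/(_ j): zpq; rewrite !mxE => <-.
  by rewrite -mulrDl subrK mul1r.
split; rewrite ?zE// ?xE ?yE mulr_gt0//=.
  by apply: le_lt_trans xpe; rewrite ler_piMl// ltW.
by apply: le_lt_trans ype; rewrite ler_piMl// ltW.
Qed.

Lemma derive1_segment : derive1 c = cst (q - p).
Proof.
apply/funext => t; rewrite derive1E.
by have [_ ->] := is_derive_line p (q - p) t.
Qed.

Lemma segment_curve_to : curve_to (interior_chart eps V) p q c.
Proof.
split.
- by rewrite /c /segment scale0r addr0.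
- exact: segment_interior.
- by apply: continuous_subspaceT; exact: continuous_line.
- move=> t _; split; last by rewrite derive1_segment; exact: cvg_cst.
  by have [] := is_derive_line p (q - p) t.
(* The affine formula also makes sense at t = 1, so the left limit is its value there. *)
- have -> : q = c 1 by rewrite /c /segment scale1r addrC subrK.
  by apply: cvg_at_left_filter; exact: continuous_line.
Qed.

(** The metric is known only on the open chart, which contains the whole segment before time 1. The
    integrand is thus a finite constant on an interval of length 1. *)
Lemma segment_length_lty {g : metric R k.+2} :
    (forall r, interior_chart eps V r -> g r = euclidean_metric r) ->
  (curve_length g c < +oo)%E.
Proof.
move=> gE; rewrite /curve_length derive1_segment.
rewrite (@eq_integral _ _ _ _ _
  (cst (speed (@euclidean_metric R _) p (q - p))%:E)); last first.
  move=> t; rewrite inE/= => t01.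
  rewrite /speed gE//; apply: segment_interior.
  by move: t01; rewrite !in_itv/= => /andP[/ltW -> ->].
by rewrite integral_cst//= lebesgue_measure_itv/= lte01 oppr0 adde0 mule1 ltry.
Qed.

End SegmentToCorner.

Theorem proposition10p4 (R : realType) (k : nat) (V : set 'rV[R]_k) (eps : R)
    (openV : open V) (eps_gt0 : 0 < eps) :
  let U : set 'rV[R]_k.+2 := interior_chart eps V in
  let mu : {finite_measure set (R * R)%type -> \bar R} := dirac ((2, 2) : R * R) in
  let u : R * R -> 'rV[R]_k.+2 -> R := fun _ _ => 1 in
  let g0 : metric R k.+2 :=
    conformal (fun p => xcoord p ^+ 2 * ycoord p ^+ 2) euclidean_metric in
  let gmu : metric R k.+2 := conformal (weight mu u) g0 in
  [/\ msupport mu = [set (2, 2)] /\ weight_data U mu u,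
      max_exponent mu = 4 /\ 2 < max_exponent mu,
      (forall p, U p ->
         gmu p = (xcoord p ^- 2 * ycoord p ^- 2) *: g0 p /\
         gmu p = euclidean_metric p),
      (forall p, U p -> (dist_to U gmu p (corner V) < +oo)%E)
    & (forall q, corner V q ->
         exists p c, [/\ U p, curve_to U p q c & (curve_length gmu c < +oo)%E])].
Proof.
move=> U mu u g0 gmu.
have muE : msupport mu = [set (2, 2)] by exact: msupport_dirac.
have weightE p : U p -> weight mu u p = xcoord p ^- 2 * ycoord p ^- 2.
  move=> [/andP[x0 _] /andP[y0 _] _].
  (* Positivity of x and y turns the real powers into integer ones. *)
  by rewrite weight_dirac mul1r/= !powRN !powR_mulrn// ltW.
have gmuE p : U p -> gmu p = euclidean_metric p.
  move=> Up; rewrite /gmu /g0 /conformal weightE// scalerA.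
  case: Up => /andP[x0 _] /andP[y0 _] _.
  by rewrite mulrACA !mulVf ?mulr1 ?scale1r// expf_neq0// gt_eqF.
have maxE : max_exponent mu = 4.
  rewrite /max_exponent muE image_set1/= maximum_set1.
  by rewrite -natrD.
split.
- split => //; split; rewrite ?muE//.
    exact: compact_set1.
  by move=> _ -> /=.
- by rewrite maxE ltr_nat.
- by move=> p Up; split; [rewrite /gmu /conformal weightE | exact: gmuE].
- move=> p Up; have Vz : V (zcoord p) by case: Up.
  (* The projection of p to the corner along the (x, y)-plane. *)
  pose q : 'rV[R]_k.+2 := @row_mx R 1 2 k 0 (zcoord p).
  have zq : zcoord p = zcoord q by rewrite /zcoord row_mxKr.
  have Cq : corner V q.
    by split; rewrite /= -?zq// /xcoord /ycoord row_mxKl mxE.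
  apply: le_lt_trans (segment_length_lty Up Cq zq gmuE).
  apply: ereal_inf_lbound; eexists; last reflexivity.
  by exists q => //; exact: segment_curve_to Up Cq zq.
- move=> q Cq; have Vz : V (zcoord q) by case: Cq.
  (* Conversely, the point over q with x = y = eps / 2 lies in the chart. *)
  pose p : 'rV[R]_k.+2 := @row_mx R 1 2 k (const_mx (eps / 2)) (zcoord q).
  have zp : zcoord p = zcoord q by rewrite /zcoord row_mxKr.
  have Up : U p.
    by split; rewrite /= ?zp// /xcoord /ycoord row_mxKl mxE divr_gt0//=
      ltr_pdivrMr// ltr_pMr// ltr1n.
  exists p, (segment p q); split => //.
    exact: segment_curve_to Up Cq zp.
  exact (segment_length_lty Up Cq zp gmuE).
Qed.
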